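(* Let $\Omega$ be a semigroup, $\lambda\in k$, $(A,(P_\alpha)_{\alpha\in\Omega})$ a Rota-Baxter family algebra of weight $\lambda$, and $H'$ a subbialgebra of the cocommutative Hopf algebra $H$. Then $H\otimes H'\otimes A$, where $H$ acts by left multiplication on the first tensor factor, is an $\Omega$-associative $H$-pseudoalgebra with the pseudoproduct $$(f\otimes a\otimes x)*_{\alpha,\beta}(g\otimes b\otimes y)=(f\otimes g a_{(1)})\otimes_H\bigl(1\otimes b a_{(2)}\otimes (P_\alpha(x)y+xP_\beta(y)+\lambda xy)\bigr),$$ for all $f,g\in H$, $a,b\in H'$, $x,y\in A$ and $\alpha,\beta\in\Omega$.
   Context: $k$ is an algebraically closed field of characteristic zero and $H$ is a cocommutative Hopf algebra over $k$ with comultiplication $\Delta(h)=h_{(1)}\otimes h_{(2)}$ (Sweedler notation); $\otimes=\otimes_k$. For $n\ge 1$, $H^{\otimes n}$ is a right $H$-module via the iterated comultiplication, and for a left $H$-module $M$ the space $H^{\otimes n}\otimes_H M$ is a left $H^{\otimes n}$-module by left multiplication. A linear map $*: L\otimes M\to H^{\otimes 2}\otimes_H N$ is $H^{\otimes 2}$-linear if $fa*gb=((f\otimes g)\otimes_H 1)(a*b)$ for all $f,g\in H$. Such maps are composed as follows: if $x*y=\sum_i (f_i\otimes g_i)\otimes_H e_i$ and $F\in H^{\otimes 2}$, then $$(F\otimes_H x)*y=\sum_i (F\otimes 1)(\Delta\otimes \mathrm{id})(f_i\otimes g_i)\otimes_H e_i,\qquad x*(F\otimes_H y)=\sum_i (1\otimes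 F)(\mathrm{id}\otimes\Delta)(f_i\otimes g_i)\otimes_H e_i,$$ elements of $H^{\otimes 3}\otimes_H N$. A Rota-Baxter family algebra of weight $\lambda$ is an associative $k$-algebra $A$ with linear operators $(P_\alpha)_{\alpha\in\Omega}$ on $A$ satisfying $P_\alpha(a)P_\beta(b)=P_{\alpha\beta}(P_\alpha(a)b+aP_\beta(b)+\lambda ab)$ for all $a,b\in A$, $\alpha,\beta\in\Omega$. An $\Omega$-associative $H$-pseudoalgebra is a left $H$-module $B$ with $H^{\otimes 2}$-linear maps (pseudoproducts) $*_{\alpha,\beta}:B\otimes B\to H^{\otimes 2}\otimes_H B$ ($\alpha,\beta\in\Omega$) such that $(a*_{\alpha,\beta}b)*_{\alpha\beta,\gamma}c=a*_{\alpha,\beta\gamma}(b*_{\beta,\gamma}c)$ for all $a,b,c\in B$, $\alpha,\beta,\gamma\in\Omega$. *)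

(* Defs.v *)
From HB Require Import structures.
From mathcomp Require Import all_boot all_order all_algebra.
From mathcomp Require Import boolp.

Set Implicit Arguments.
Unset Strict Implicit.
Unset Printing Implicit Defensive.

Import GRing.Theory.
Local Open Scope ring_scope.
Local Open Scope quotient_scope.

Reserved Notation "x ⊗ y" (at level 40, left associativity).
Reserved Notation "F ⊗H m" (at level 40, left associativity).

(* Tensor products over k of arbitrary modules, and the tensor products over  *)
(* a Hopf algebra H, are both instances of [btensor ra la]: formal sums of    *)
(* pairs (x, m), encoded as sequences, modulo biadditivity and the balancing  *)
(* relation (x . s, m) ~ (x, s . m) for a right action ra and a left action   *)
(* la of S. There is no formal opposite: - (x, m) is (- x, m), and the rule   *)
(* [bt_zero] makes this an inverse.                                           *)
Section BalancedTensor.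
Variables (k : comNzRingType) (X M : lmodType k) (S : Type).
Variables (ra : S -> {linear X -> X}) (la : S -> M -> M).

Inductive btensor_eq : seq (X * M) -> seq (X * M) -> Prop :=
| bt_refl s : btensor_eq s s
| bt_sym s t : btensor_eq s t -> btensor_eq t s
| bt_trans s t u : btensor_eq s t -> btensor_eq t u -> btensor_eq s u
| bt_cat s s' t t' :
    btensor_eq s s' -> btensor_eq t t' -> btensor_eq (s ++ t) (s' ++ t')
| bt_catC s t : btensor_eq (s ++ t) (t ++ s)
| bt_addl x y m : btensor_eq [:: (x + y, m)] [:: (x, m); (y, m)]
| bt_addr x m n : btensor_eq [:: (x, m + n)] [:: (x, m); (x, n)]
| bt_bal x s m : btensor_eq [:: (ra s x, m)] [:: (x, la s m)]
| bt_zero m : btensor_eq [:: (0, m)] [::].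

Definition btensor_rel : rel (seq (X * M)) := fun s t => `[< btensor_eq s t >].

Lemma btensor_rel_refl : reflexive btensor_rel.
Proof. by move=> s; apply/asboolP/bt_refl. Qed.

Lemma btensor_rel_sym : symmetric btensor_rel.
Proof. by move=> s t; apply/asboolP/asboolP => /bt_sym. Qed.

Lemma btensor_rel_trans : transitive btensor_rel.
Proof. by move=> s t u /asboolP st /asboolP tu; apply/asboolP/(bt_trans st). Qed.

Canonical btensor_equiv :=
  EquivRel btensor_rel btensor_rel_refl btensor_rel_sym btensor_rel_trans.

Definition btensor := {eq_quot btensor_equiv}.
HB.instance Definition _ := Choice.copy btensor {eq_quot btensor_equiv}.

Local Notation cls := (\pi_btensor : seq (X * M) -> btensor).

Lemma cls_eqP s t : reflect (cls s = cls t) `[< btensor_eq s t >].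
Proof. exact: eqmodP. Qed.

Lemma cls_eq s t : btensor_eq s t -> cls s = cls t.
Proof. by move=> st; apply/cls_eqP/asboolP. Qed.

Lemma cls_repr (t : btensor) : cls (repr t) = t.
Proof. exact: reprK. Qed.

Lemma repr_cls s : btensor_eq (repr (cls s)) s.
Proof. by apply/asboolP/cls_eqP; rewrite reprK. Qed.

Lemma bt_perm s t : perm_eq s t -> btensor_eq s t.
Proof.
move=> st; apply: (catCA_perm_ind _ st) (bt_refl s) => s1 s2 s3 ss.
apply: bt_trans ss _; rewrite !catA.
exact: bt_cat (bt_catC _ _) (bt_refl _).
Qed.

Definition bt_map (f : X -> X) (s : seq (X * M)) := [seq (f p.1, p.2) | p <- s].

Lemma bt_map_eq (f : {additive X -> X}) (fra : forall s x, f (ra s x) = ra s (f x))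
  s t : btensor_eq s t -> btensor_eq (bt_map f s) (bt_map f t).
Proof.
elim=> [u|u v _|u v w _ uv _ vw|u u' v v' _ uu' _ vv'|u v|x y m|x m n|x c m|m].
- exact: bt_refl.
- exact: bt_sym.
- exact: bt_trans uv vw.
- by rewrite /bt_map !map_cat; exact: bt_cat.
- by rewrite /bt_map !map_cat; exact: bt_catC.
- by rewrite /= raddfD; exact: bt_addl.
- exact: bt_addr.
- by rewrite /= fra; exact: bt_bal.
- by rewrite /= raddf0; exact: bt_zero.
Qed.

Let add (t u : btensor) := cls (repr t ++ repr u).
Let opp (t : btensor) := cls (bt_map -%R (repr t)).
Let scale (c : k) (t : btensor) := cls (bt_map ( *:%R c) (repr t)).

Lemma bt_addE s t : add (cls s) (cls t) = cls (s ++ t).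
Proof. by apply: cls_eq; apply: bt_cat; exact: repr_cls. Qed.

Lemma bt_oppE s : opp (cls s) = cls (bt_map -%R s).
Proof.
apply: cls_eq; apply: bt_map_eq (repr_cls s) => c x.
by rewrite raddfN.
Qed.

Lemma bt_scaleE c s : scale c (cls s) = cls (bt_map ( *:%R c) s).
Proof.
by apply: cls_eq; apply: bt_map_eq (repr_cls s) => a x; rewrite linearZ.
Qed.

Lemma bt_addA : associative add.
Proof.
move=> t u v; rewrite -(cls_repr t) -(cls_repr u) -(cls_repr v).
by rewrite !bt_addE catA.
Qed.

Lemma bt_addC : commutative add.
Proof. by move=> t u; apply: cls_eq; exact: bt_catC. Qed.

Lemma bt_add0 : left_id (cls [::]) add.
Proof. by move=> t; rewrite -(cls_repr t) bt_addE. Qed.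

Lemma bt_addN : left_inverse (cls [::]) opp add.
Proof.
move=> t; rewrite -(cls_repr t) bt_oppE bt_addE; apply: cls_eq.
elim: (repr t) => [|[x m] s IHs]; first exact: bt_refl.
apply: (bt_trans (t := [:: (- x, m); (x, m)] ++ (bt_map -%R s ++ s))).
  by apply: bt_perm; rewrite /= perm_cons perm_catC /= perm_cons perm_catC.
rewrite -[[::]]cat0s; apply: bt_cat IHs.
apply: bt_trans (bt_sym (bt_addl _ _ _)) _; rewrite addNr; exact: bt_zero.
Qed.

HB.instance Definition _ :=
  GRing.isZmodule.Build btensor bt_addA bt_addC bt_add0 bt_addN.

Lemma cls_cat s t : cls (s ++ t) = cls s + cls t.
Proof. exact/esym/bt_addE. Qed.

Lemma bt_scaleA a b (t : btensor) : scale a (scale b t) = scale (a * b) t.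
Proof.
rewrite -(cls_repr t) !bt_scaleE /bt_map -map_comp; congr cls.
by apply: eq_map => p /=; rewrite scalerA.
Qed.

Lemma bt_scale1 : left_id 1 scale.
Proof.
move=> t; rewrite -(cls_repr t) bt_scaleE; congr cls.
by rewrite -[RHS]map_id; apply: eq_map => -[x m] /=; rewrite scale1r.
Qed.

Lemma bt_scaleDr : right_distributive scale +%R.
Proof.
move=> a t u; rewrite -(cls_repr t) -(cls_repr u) -cls_cat !bt_scaleE -cls_cat.
by rewrite /bt_map map_cat.
Qed.

Lemma bt_scaleDl t : {morph scale^~ t : a b / a + b}.
Proof.
move=> a b; rewrite -(cls_repr t) !bt_scaleE -cls_cat; apply: cls_eq.
elim: (repr t) => [|[x m] s IHs]; first exact: bt_refl.
apply: (bt_trans (t := [:: (a *: x, m); (b *: x, m)] ++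
                       (bt_map ( *:%R a) s ++ bt_map ( *:%R b) s))).
  rewrite /= scalerDl -[_ :: bt_map _ s]cat1s.
  exact: bt_cat (bt_addl _ _ _) IHs.
by apply: bt_perm; rewrite /= perm_cons perm_sym perm_catC /= perm_cons perm_catC.
Qed.

HB.instance Definition _ := GRing.Zmodule_isLmodule.Build k btensor
  bt_scaleA bt_scale1 bt_scaleDr bt_scaleDl.

Definition btens (x : X) (m : M) : btensor := cls [:: (x, m)].

Lemma btensDl m : {morph btens^~ m : x y / x + y}.
Proof. by move=> x y; rewrite -cls_cat; apply: cls_eq; exact: bt_addl. Qed.

Lemma btensDr x : {morph btens x : m n / m + n}.
Proof. by move=> m n; rewrite -cls_cat; apply: cls_eq; exact: bt_addr. Qed.

Lemma btens_bal x s m : btens (ra s x) m = btens x (la s m).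
Proof. by apply: cls_eq; exact: bt_bal. Qed.

Lemma btensZl c x m : btens (c *: x) m = c *: btens x m.
Proof. by rewrite /btens [RHS]bt_scaleE. Qed.

Lemma btens0l m : btens 0 m = 0.
Proof. by apply: cls_eq; exact: bt_zero. Qed.

Lemma cls_sum s : cls s = \sum_(p <- s) btens p.1 p.2.
Proof.
elim: s => [|[x m] s IHs]; first by rewrite big_nil.
by rewrite -cat1s cls_cat IHs big_cons.
Qed.

Lemma btensE (t : btensor) : t = \sum_(p <- repr t) btens p.1 p.2.
Proof. by rewrite -cls_sum cls_repr. Qed.

Lemma btensor_ind (P : btensor -> Prop) :
  P 0 -> (forall x m t, P t -> P (btens x m + t)) -> forall t, P t.
Proof.
move=> P0 PS t; rewrite (btensE t); elim: (repr t) => [|p s IHs].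
  by rewrite big_nil.
by rewrite big_cons; exact: PS.
Qed.

(* The extension of f to the tensor product. It is evaluated on a chosen      *)
(* representative, so it is the expected map only when f is biadditive and    *)
(* balanced, see [blift_btens].                                               *)
Definition blift (V : zmodType) (f : X -> M -> V) (t : btensor) : V :=
  \sum_(p <- repr t) f p.1 p.2.

Definition balanced (V : zmodType) (f : X -> M -> V) : Prop :=
  [/\ forall m, {morph f^~ m : x y / x + y},
      forall x, {morph f x : m n / m + n} &
      forall x s m, f (ra s x) m = f x (la s m)].

Section Lift.
Variables (V : zmodType) (f : X -> M -> V) (fb : balanced f).

Lemma balanced0l m : f 0 m = 0.
Proof.
by case: fb => fDl _ _; apply: (addrI (f 0 m)); rewrite -fDl !addr0.
Qed.

Lemma blift_eq s t : btensor_eq s t ->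
  \sum_(p <- s) f p.1 p.2 = \sum_(p <- t) f p.1 p.2.
Proof.
case: (fb) => fDl fDr fbal.
elim=> {s t} [//|s t _ -> //|s t u _ -> _ -> //|s s' t t' _ ss _ tt|s t|x y m|x m n|x s m|m].
- by rewrite !big_cat /= ss tt.
- by rewrite !big_cat /= addrC.
- by rewrite !big_cons !big_nil !addr0 fDl.
- by rewrite !big_cons !big_nil !addr0 fDr.
- by rewrite !big_seq1 fbal.
- by rewrite big_seq1 big_nil balanced0l.
Qed.

Lemma blift_cls s : blift f (cls s) = \sum_(p <- s) f p.1 p.2.
Proof. exact/blift_eq/repr_cls. Qed.

Lemma blift_btens x m : blift f (btens x m) = f x m.
Proof. by rewrite blift_cls big_seq1. Qed.

Lemma bliftD : {morph blift f : t u / t + u}.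
Proof.
move=> t u; rewrite -(cls_repr t) -(cls_repr u) -cls_cat !blift_cls.
by rewrite big_cat.
Qed.

Lemma blift0 : blift f 0 = 0.
Proof. by rewrite blift_cls big_nil. Qed.

End Lift.

Lemma bliftZ (V : lmodType k) (f : X -> M -> V) (fb : balanced f) :
  (forall c x m, f (c *: x) m = c *: f x m) ->
  forall c t, blift f (c *: t) = c *: blift f t.
Proof.
move=> fZ c; apply: btensor_ind => [|x m t IHt].
  by rewrite scaler0 (blift0 fb) scaler0.
by rewrite scalerDr !(bliftD fb) scalerDr IHt -btensZl !(blift_btens fb) fZ.
Qed.

Lemma eq_btensor (V : zmodType) (f g : btensor -> V) :
  {morph f : t u / t + u} -> {morph g : t u / t + u} ->
  (forall x m, f (btens x m) = g (btens x m)) -> f =1 g.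
Proof.
move=> fD gD fg; apply: btensor_ind => [|x m t IHt].
  have z (h : btensor -> V) : {morph h : t u / t + u} -> h 0 = 0.
    by move=> hD; apply: (addrI (h 0)); rewrite -hD !addr0.
  by rewrite !z.
by rewrite fD gD fg IHt.
Qed.

End BalancedTensor.

Arguments btens {k X M S ra la} x m.
Arguments blift {k X M S ra la V} f t.

Section Tensor.
Variable k : comNzRingType.
Implicit Types X Y Z V : lmodType k.

Definition tensor X Y := btensor (fun c : k => *:%R c : {linear X -> X})
                                 (fun c : k => *:%R c : Y -> Y).
HB.instance Definition _ X Y := GRing.Lmodule.on (tensor X Y).

Definition tens X Y (x : X) (y : Y) : tensor X Y := btens x y.

End Tensor.

Arguments tensor {k} (X Y)%_type_scope.
Notation "U ⊗ V" := (tensor U V) : type_scope.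
Notation "x ⊗ y" := (tens x y) : ring_scope.

Section TensorTheory.
Variable k : comNzRingType.
Implicit Types X Y Z V : lmodType k.

Lemma tensDl X Y (y : Y) : {morph (fun x : X => x ⊗ y) : x x' / x + x'}.
Proof. exact: btensDl. Qed.

Lemma tensDr X Y (x : X) : {morph (fun y : Y => x ⊗ y) : y y' / y + y'}.
Proof. exact: btensDr. Qed.

Lemma tens0l X Y (y : Y) : (0 : X) ⊗ y = 0.
Proof. exact: btens0l. Qed.

Lemma tensZl X Y c (x : X) (y : Y) : (c *: x) ⊗ y = c *: (x ⊗ y).
Proof. exact: btensZl. Qed.

Lemma tensZr X Y c (x : X) (y : Y) : x ⊗ (c *: y) = c *: (x ⊗ y).
Proof. by rewrite -tensZl; apply/esym/btens_bal. Qed.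

Lemma tens0r X Y (x : X) : x ⊗ (0 : Y) = 0.
Proof. by rewrite -(scale0r (0 : Y)) tensZr scale0r. Qed.

Definition bilin X Y V (f : X -> Y -> V) : Prop :=
  (forall y, linear (f^~ y)) /\ (forall x, linear (f x)).

Lemma linD X V (f : X -> V) : linear f -> {morph f : x y / x + y}.
Proof. by move=> fl x y; have := fl 1 x y; rewrite !scale1r. Qed.

Lemma lin0 X V (f : X -> V) : linear f -> f 0 = 0.
Proof. by move=> fl; apply: (addrI (f 0)); rewrite -(linD fl) !addr0. Qed.

Lemma linZ X V (f : X -> V) : linear f -> forall c x, f (c *: x) = c *: f x.
Proof. by move=> fl c x; have := fl c x 0; rewrite (lin0 fl) !addr0. Qed.

Lemma bilin_balanced X Y V (f : X -> Y -> V) : bilin f ->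
  balanced (fun c : k => *:%R c : {linear X -> X}) (fun c : k => *:%R c : Y -> Y) f.
Proof.
move=> [fl fr]; split=> [y x x'|x y y'|x c y].
- exact: (linD (fl y)).
- exact: (linD (fr x)).
- by rewrite (linZ (fl y)) (linZ (fr x)).
Qed.

Definition tlift X Y V (f : X -> Y -> V) (t : X ⊗ Y) : V := blift f t.

Lemma tlift_tens X Y V (f : X -> Y -> V) x y :
  bilin f -> tlift f (x ⊗ y) = f x y.
Proof. by move=> /bilin_balanced fb; exact: (blift_btens fb). Qed.

Lemma tlift_is_linear X Y V (f : X -> Y -> V) : bilin f -> linear (tlift f).
Proof.
move=> fb c t u; rewrite [LHS](bliftD (bilin_balanced fb)); congr (_ + _).
by apply: (bliftZ (bilin_balanced fb)) => {}c x y; exact: (linZ (fb.1 y)).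
Qed.

Lemma tensor_ind X Y (P : X ⊗ Y -> Prop) :
  P 0 -> (forall x y t, P t -> P (x ⊗ y + t)) -> forall t, P t.
Proof. exact: btensor_ind. Qed.

Lemma eq_tensor X Y (V : zmodType) (f g : X ⊗ Y -> V) :
  {morph f : t u / t + u} -> {morph g : t u / t + u} ->
  (forall x y, f (x ⊗ y) = g (x ⊗ y)) -> f =1 g.
Proof. exact: eq_btensor. Qed.

Section Map.
Variables (X X' Y Y' : lmodType k).
Variables (f : {linear X -> X'}) (g : {linear Y -> Y'}).

Definition tmap : X ⊗ Y -> X' ⊗ Y' := tlift (fun x y => f x ⊗ g y).

Lemma tmap_bilin : bilin (fun x y => f x ⊗ g y).
Proof.
by split=> [y c x x'|x c y y']; rewrite linearP ?tensDl ?tensDr ?tensZl ?tensZr.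
Qed.

HB.instance Definition _ :=
  GRing.isLinear.Build k (X ⊗ Y)%type (X' ⊗ Y')%type *:%R tmap (tlift_is_linear tmap_bilin).

Lemma tmap_tens x y : tmap (x ⊗ y) = f x ⊗ g y.
Proof. exact: tlift_tens tmap_bilin. Qed.
End Map.

Section Swap.
Variables (X Y : lmodType k).

Definition tswap : X ⊗ Y -> Y ⊗ X := tlift (fun x y => y ⊗ x).

Lemma tswap_bilin : bilin (fun (x : X) (y : Y) => y ⊗ x).
Proof.
by split=> [y c x x'|x c y y']; rewrite ?(tensDl, tensDr) ?(tensZl, tensZr).
Qed.

HB.instance Definition _ :=
  GRing.isLinear.Build k (X ⊗ Y)%type (Y ⊗ X)%type *:%R tswap (tlift_is_linear tswap_bilin).

Lemma tswap_tens x y : tswap (x ⊗ y) = y ⊗ x.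
Proof. exact: tlift_tens tswap_bilin. Qed.
End Swap.

Section Assoc.
Variables (X Y Z : lmodType k).

Definition tassoc : X ⊗ (Y ⊗ Z) -> (X ⊗ Y) ⊗ Z :=
  tlift (fun x => tlift (fun y z => (x ⊗ y) ⊗ z)).

Lemma tassoc_bilin_in x : bilin (fun (y : Y) (z : Z) => (x ⊗ y : X ⊗ Y) ⊗ z).
Proof.
by split=> [z c y y'|y c z z']; rewrite ?(tensDr, tensDl) ?(tensZr, tensZl) ?tensDr ?tensDl ?tensZr ?tensZl.
Qed.

Lemma tassoc_bilin : bilin (fun x : X => tlift (fun (y : Y) (z : Z) => (x ⊗ y) ⊗ z)).
Proof.
split=> [t c x x'|x]; last exact: tlift_is_linear (tassoc_bilin_in x).
elim/tensor_ind: t => [|y z t IHt].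
  by rewrite !(lin0 (tlift_is_linear (tassoc_bilin_in _))) scaler0 addr0.
rewrite !(linD (tlift_is_linear (tassoc_bilin_in _))) IHt.
rewrite !tlift_tens; try exact: tassoc_bilin_in.
by rewrite !tensDl !tensZl scalerDr addrACA.
Qed.

HB.instance Definition _ := GRing.isLinear.Build k (X ⊗ (Y ⊗ Z))%type ((X ⊗ Y) ⊗ Z)%type
  *:%R tassoc (tlift_is_linear tassoc_bilin).

Lemma tassoc_tens x y z : tassoc (x ⊗ (y ⊗ z)) = (x ⊗ y) ⊗ z.
Proof.
by rewrite [LHS](tlift_tens _ _ tassoc_bilin) (tlift_tens _ _ (tassoc_bilin_in x)).
Qed.
End Assoc.

End TensorTheory.

HB.mixin Record hasCounit (k : comNzRingType) (A : Type) of GRing.Algebra k A := {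
  counit_subdef : {lrmorphism A -> k^o}
}.

#[short(type="augAlgType")]
HB.structure Definition AugAlgebra (k : comNzRingType) :=
  {A of hasCounit k A & GRing.Algebra k A}.

Definition counit {k : comNzRingType} {A : augAlgType k} (a : A) : k^o :=
  counit_subdef a.

Lemma counit_is_linear (k : comNzRingType) (A : augAlgType k) :
  linear (@counit k A).
Proof. exact: linearP. Qed.

Lemma counit_is_monoid_morphism (k : comNzRingType) (A : augAlgType k) :
  monoid_morphism (@counit k A).
Proof. by split; [exact: rmorph1 | exact: rmorphM]. Qed.

HB.instance Definition _ (k : comNzRingType) (A : augAlgType k) :=
  GRing.isLinear.Build k A k^o *:%R (@counit k A) (@counit_is_linear k A).
HB.instance Definition _ (k : comNzRingType) (A : augAlgType k) :=
  GRing.isMonoidMorphism.Build A k^o (@counit k A)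
    (@counit_is_monoid_morphism k A).

(* The algebra structure on a tensor product is only built for augmented      *)
(* algebras: the counit is what shows that 1 ⊗ 1 is nonzero, which the        *)
(* library requires of an algebra.                                            *)
Section TensorAlgebra.
Variables (k : comNzRingType) (A B : augAlgType k).

Definition tmul (t u : A ⊗ B) : A ⊗ B :=
  tlift (fun a b => tmap (a \*o idfun) (b \*o idfun) u) t.

Lemma tmul_bilin (u : A ⊗ B) :
  bilin (fun a b => tmap (a \*o idfun) (b \*o idfun) u).
Proof.
split=> [b c a a'|a c b b']; elim/tensor_ind: u => [|x y u IHu].
- by rewrite !linear0 addr0.
- rewrite !linearD /= IHu !tmap_tens /= mulrDl -scalerAl tensDl tensZl.
  by rewrite addrACA.
- by rewrite !linear0 addr0.
- rewrite !linearD /= IHu !tmap_tens /= mulrDl -scalerAl tensDr tensZr.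
  by rewrite addrACA.
Qed.

Lemma tmul_tens (a c : A) (b d : B) :
  tmul (a ⊗ b) (c ⊗ d) = (a * c) ⊗ (b * d).
Proof. by rewrite [LHS](tlift_tens _ _ (tmul_bilin _)) tmap_tens. Qed.

Lemma tmulPl (u : A ⊗ B) : linear (tmul^~ u).
Proof. exact: tlift_is_linear (tmul_bilin u). Qed.

Lemma tmulPr (t : A ⊗ B) : linear (tmul t).
Proof.
move=> c u v; elim/tensor_ind: t => [|x y t IHt].
  by rewrite !(lin0 (tmulPl _)) scaler0 addr0.
rewrite !(linD (tmulPl _)) IHt scalerDr addrACA; congr (_ + _).
by rewrite /tmul !(tlift_tens _ _ (tmul_bilin _)) linearP.
Qed.

Lemma tmulA : associative tmul.
Proof.
move=> t u v; elim/tensor_ind: t => [|a b t IHt].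
  by rewrite !(lin0 (tmulPl _)).
rewrite !(linD (tmulPl _)) IHt; congr (_ + _) => {t IHt}.
elim/tensor_ind: u => [|c d u IHu].
  by rewrite (lin0 (tmulPr _)) !(lin0 (tmulPl _)) (lin0 (tmulPr _)).
rewrite (linD (tmulPl _)) !(linD (tmulPr _)) (linD (tmulPl _)) IHu.
congr (_ + _) => {u IHu}.
elim/tensor_ind: v => [|e f v IHv]; first by rewrite !(lin0 (tmulPr _)).
by rewrite !(linD (tmulPr _)) IHv !tmul_tens !mulrA.
Qed.

Lemma tmul1t : left_id (1 ⊗ 1) tmul.
Proof.
elim/tensor_ind=> [|a b t IHt]; first by rewrite (lin0 (tmulPr _)).
by rewrite (linD (tmulPr _)) IHt tmul_tens !mul1r.
Qed.

Lemma tmult1 : right_id (1 ⊗ 1) tmul.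
Proof.
elim/tensor_ind=> [|a b t IHt]; first by rewrite (lin0 (tmulPl _)).
by rewrite (linD (tmulPl _)) IHt tmul_tens !mulr1.
Qed.

Definition tcounit : A ⊗ B -> k^o :=
  tlift (fun (a : A) (b : B) => counit a * counit b : k^o).

Lemma tcounit_bilin : bilin (fun (a : A) (b : B) => counit a * counit b : k^o).
Proof.
by split=> [b c a a'|a c b b']; rewrite linearP ?mulrDl ?mulrDr
  -?scalerAl -?scalerAr.
Qed.

HB.instance Definition _ := GRing.isLinear.Build k (A ⊗ B)%type k^o *:%R
  tcounit (tlift_is_linear tcounit_bilin).

Lemma tcounit_tens a b : tcounit (a ⊗ b) = counit a * counit b.
Proof. exact: tlift_tens tcounit_bilin. Qed.

Lemma tens11_neq0 : (1 : A) ⊗ (1 : B) != 0.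
Proof.
apply/eqP => /(congr1 tcounit).
rewrite tcounit_tens !rmorph1 mulr1 linear0.
exact/eqP/oner_neq0.
Qed.

HB.instance Definition _ := GRing.Zmodule_isNzRing.Build (A ⊗ B)%type
  tmulA tmul1t tmult1 (fun t u v => linD (tmulPl v) t u)
  (fun t u v => linD (tmulPr t) u v) tens11_neq0.

HB.instance Definition _ := GRing.Lmodule_isLalgebra.Build k (A ⊗ B)%type
  (fun c t u => esym (linZ (tmulPl u) c t)).

HB.instance Definition _ := GRing.Lalgebra_isAlgebra.Build k (A ⊗ B)%type
  (fun c t u => esym (linZ (tmulPr t) c u)).

Lemma tensM (a c : A) (b d : B) : (a ⊗ b) * (c ⊗ d) = (a * c) ⊗ (b * d).
Proof. exact: tmul_tens. Qed.

Lemma tens11 : (1 : A) ⊗ (1 : B) = 1.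
Proof. by []. Qed.

Lemma tcounit_monoid : monoid_morphism tcounit.
Proof.
split=> [|t u]; first by rewrite -tens11 tcounit_tens !rmorph1 mulr1.
elim/tensor_ind: t => [|a b t IHt]; first by rewrite mul0r linear0 mul0r.
rewrite mulrDl !linearD /= mulrDl IHt; congr (_ + _) => {t IHt}.
elim/tensor_ind: u => [|c d u IHu]; first by rewrite mulr0 linear0 mulr0.
rewrite mulrDr !linearD /= mulrDr IHu tensM !tcounit_tens !rmorphM.
by rewrite mulrACA.
Qed.

HB.instance Definition _ :=
  GRing.isMonoidMorphism.Build (A ⊗ B)%type k^o tcounit tcounit_monoid.

HB.instance Definition _ := hasCounit.Build k (A ⊗ B)%type
  (tcounit : {lrmorphism (A ⊗ B)%type -> k^o}).

End TensorAlgebra.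

Section TensorAlgebraMorphisms.
Variable k : comNzRingType.

Lemma tmapM (A A' B B' : augAlgType k) (f : {lrmorphism A -> A'})
    (g : {lrmorphism B -> B'}) : {morph tmap f g : t u / t * u}.
Proof.
move=> t u; elim/tensor_ind: t => [|a b t IHt].
  by rewrite mul0r linear0 mul0r.
rewrite mulrDl !linearD /= mulrDl IHt; congr (_ + _) => {t IHt}.
elim/tensor_ind: u => [|c d u IHu]; first by rewrite mulr0 linear0 mulr0.
by rewrite mulrDr !linearD /= mulrDr IHu tensM !tmap_tens tensM !rmorphM.
Qed.

Lemma tassocM (A B C : augAlgType k) : {morph @tassoc k A B C : t u / t * u}.
Proof.
move=> t u; elim/tensor_ind: t => [|a t' t IHt].
  by rewrite mul0r linear0 mul0r.
rewrite mulrDl !linearD /= mulrDl IHt; congr (_ + _) => {t IHt}.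
elim/tensor_ind: u => [|c u' u IHu]; first by rewrite mulr0 linear0 mulr0.
rewrite mulrDr !linearD /= mulrDr IHu; congr (_ + _) => {u IHu}.
rewrite tensM; elim/tensor_ind: t' => [|b b' t' IHt].
  by rewrite mul0r !tens0r !linear0 mul0r.
rewrite mulrDl !tensDr !linearD /= mulrDl IHt; congr (_ + _) => {t' IHt}.
elim/tensor_ind: u' => [|d d' u' IHu].
  by rewrite mulr0 !tens0r !linear0 mulr0.
rewrite mulrDr !tensDr !linearD /= mulrDr IHu; congr (_ + _).
by rewrite !tassoc_tens !tensM tassoc_tens.
Qed.

End TensorAlgebraMorphisms.

HB.mixin Record AugAlgebra_isBialgebra (k : comNzRingType) (H : Type)
    of AugAlgebra k H := {
  comul_subdef : {lrmorphism H -> tensor H H};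
  comulA_subproof : forall h,
    tassoc (tmap idfun comul_subdef (comul_subdef h)) =
    tmap comul_subdef idfun (comul_subdef h);
  counitl_subproof : forall h,
    tlift (fun a b : H => counit a *: b) (comul_subdef h) = h;
  counitr_subproof : forall h,
    tlift (fun a b : H => counit b *: a) (comul_subdef h) = h
}.

#[short(type="bialgType")]
HB.structure Definition Bialgebra (k : comNzRingType) :=
  {H of AugAlgebra k H & AugAlgebra_isBialgebra k H}.

(* Restated over bialgType: the type of the field [comul_subdef] mentions an   *)
(* unfolded structure, on which unification is slow.                          *)
Definition comul {k : comNzRingType} {H : bialgType k} (h : H) : H ⊗ H :=
  comul_subdef h.

Lemma comul_is_linear (k : comNzRingType) (H : bialgType k) : linear (@comul k H).
Proof. exact: linearP. Qed.

Lemma comul_is_monoid_morphism (k : comNzRingType) (H : bialgType k) :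
  monoid_morphism (@comul k H).
Proof. by split; [exact: rmorph1 | exact: rmorphM]. Qed.

HB.instance Definition _ (k : comNzRingType) (H : bialgType k) :=
  GRing.isLinear.Build k H (H ⊗ H)%type *:%R (@comul k H) (@comul_is_linear k H).
HB.instance Definition _ (k : comNzRingType) (H : bialgType k) :=
  GRing.isMonoidMorphism.Build H (H ⊗ H)%type (@comul k H)
    (@comul_is_monoid_morphism k H).

Section BialgebraTheory.
Variables (k : comNzRingType) (H : bialgType k).
Implicit Type h : H.

Lemma counitK_l h : tlift (fun a b : H => (counit a : k) *: b) (comul h) = h.
Proof. exact: counitl_subproof. Qed.

Lemma counitK_r h : tlift (fun a b : H => (counit b : k) *: a) (comul h) = h.
Proof. exact: counitr_subproof. Qed.

End BialgebraTheory.

(* H^{⊗3} is taken to be (H ⊗ H) ⊗ H; [comul_l], [comul_r] are Delta ⊗ id and  *)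
(* id ⊗ Delta.                                                                *)
Section IteratedComul.
Variables (k : comNzRingType) (H : bialgType k).
Implicit Types (h : H) (F G : (H ⊗ H)%type).

Definition comul_l F : (H ⊗ H) ⊗ H := tmap comul idfun F.
Definition comul_r F : (H ⊗ H) ⊗ H := tassoc (tmap idfun comul F).
Definition comul3 h : (H ⊗ H) ⊗ H := comul_l (comul h).

Lemma comulA h : comul_r (comul h) = comul_l (comul h).
Proof. exact: comulA_subproof. Qed.

Lemma comul_lD : {morph comul_l : F G / F + G}.
Proof. exact: linearD. Qed.

Lemma comul_rD : {morph comul_r : F G / F + G}.
Proof. by move=> F G; rewrite /comul_r !linearD. Qed.

Lemma comul_lM : {morph comul_l : F G / F * G}.
Proof. exact: tmapM. Qed.

Lemma comul_rM : {morph comul_r : F G / F * G}.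
Proof.
move=> F G; rewrite /comul_r.
have -> : tmap idfun comul (F * G) = tmap idfun comul F * tmap idfun comul G.
  exact: tmapM.
exact: (@tassocM k H H H).
Qed.

Lemma comul_l_comul h : comul_l (comul h) = comul3 h.
Proof. by []. Qed.

Lemma comul_r_comul h : comul_r (comul h) = comul3 h.
Proof. exact: comulA. Qed.

Lemma comul_l_tens (f g : H) : comul_l (f ⊗ g) = comul f ⊗ g.
Proof. exact: tmap_tens. Qed.

Lemma comul_r_tens (f g : H) : comul_r (f ⊗ g) = tassoc (f ⊗ comul g).
Proof. by rewrite /comul_r tmap_tens. Qed.

Lemma embed_lD F G :
  (F + G) ⊗ (1 : H) = F ⊗ 1 + G ⊗ 1 :> ((H ⊗ H) ⊗ H)%type.
Proof. exact: tensDl. Qed.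

Lemma embed_rD F G :
  tassoc ((1 : H) ⊗ (F + G)) = tassoc (1 ⊗ F) + tassoc (1 ⊗ G).
Proof. by rewrite tensDr linearD. Qed.

Lemma embed_lM F G :
  (F * G) ⊗ (1 : H) = (F ⊗ 1) * (G ⊗ 1) :> ((H ⊗ H) ⊗ H)%type.
Proof. by rewrite tensM mulr1. Qed.

Lemma embed_rM F G :
  tassoc ((1 : H) ⊗ (F * G)) = tassoc (1 ⊗ F) * tassoc (1 ⊗ G).
Proof.
apply: etrans (tassocM _ _); congr (tassoc _).
by rewrite tensM mulr1.
Qed.

End IteratedComul.

HB.mixin Record Bialgebra_isHopf (k : comNzRingType) (H : Type)
    of Bialgebra k H := {
  antipode_subdef : {linear H -> H};
  antipodel_subproof : forall h : H,
    tlift (fun a b : H => antipode_subdef a * b) (comul h) = (counit h : k)%:A;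
  antipoder_subproof : forall h : H,
    tlift (fun a b : H => a * antipode_subdef b) (comul h) = (counit h : k)%:A
}.

#[short(type="hopfAlgType")]
HB.structure Definition HopfAlgebra (k : comNzRingType) :=
  {H of Bialgebra k H & Bialgebra_isHopf k H}.

HB.mixin Record Bialgebra_isCocommutative (k : comNzRingType) (H : Type)
    of Bialgebra k H := {
  comulC_subproof : forall h : H, tswap (comul h) = comul h
}.

#[short(type="cocomHopfAlgType")]
HB.structure Definition CocomHopfAlgebra (k : comNzRingType) :=
  {H of HopfAlgebra k H & Bialgebra_isCocommutative k H}.

Section HopfTheory.
Variable k : comNzRingType.

Definition antipode {H : hopfAlgType k} (h : H) : H := antipode_subdef h.

Lemma antipode_is_linear (H : hopfAlgType k) : linear (@antipode H).
Proof. exact: linearP. Qed.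

HB.instance Definition _ (H : hopfAlgType k) :=
  GRing.isLinear.Build k H H *:%R (@antipode H) (@antipode_is_linear H).

Lemma antipodeK_l (H : hopfAlgType k) (h : H) :
  tlift (fun a b : H => antipode a * b) (comul h) = (counit h : k)%:A.
Proof. exact: antipodel_subproof. Qed.

Lemma antipodeK_r (H : hopfAlgType k) (h : H) :
  tlift (fun a b : H => a * antipode b) (comul h) = (counit h : k)%:A.
Proof. exact: antipoder_subproof. Qed.

Lemma comulC (H : cocomHopfAlgType k) (h : H) : tswap (comul h) = comul h.
Proof. exact: comulC_subproof. Qed.

End HopfTheory.

(* Left H-modules, as k-modules with a k-bilinear action of H. *)
HB.mixin Record Lmodule_isHModule (k : comNzRingType) (H : algType k) (M : Type)
    of GRing.Lmodule k M := {
  hact : H -> M -> M;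
  hact_bilin : bilin hact;
  hactA : forall g h m, hact g (hact h m) = hact (g * h) m;
  hact1 : forall m, hact 1 m = m
}.

#[short(type="hmodType")]
HB.structure Definition HModule (k : comNzRingType) (H : algType k) :=
  {M of GRing.Lmodule k M & Lmodule_isHModule k H M}.

(* T ⊗_H M for an algebra T on which H acts on the right through delta; it is *)
(* used with T = H ⊗ H, (H ⊗ H) ⊗ H and the iterated comultiplications.       *)
Section HTensor.
Variables (k : comNzRingType) (H T : algType k) (delta : H -> T).
Variable M : hmodType H.

Definition hract (h : H) : {linear T -> T} := delta h \o* idfun.

Definition htensor := btensor hract (@hact k H M).
HB.instance Definition _ := GRing.Lmodule.on htensor.

Definition htens (F : T) (m : M) : htensor := btens F m.

Definition hscale (G : T) (t : htensor) : htensor :=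
  blift (fun F m => htens (G * F) m) t.

Lemma htensDl m : {morph htens^~ m : F G / F + G}.
Proof. exact: btensDl. Qed.

Lemma htensDr F : {morph htens F : m n / m + n}.
Proof. exact: btensDr. Qed.

Lemma htens_mulDl G m : {morph (fun F => htens (F * G) m) : F F' / F + F'}.
Proof. by move=> F F'; rewrite mulrDl htensDl. Qed.

Lemma htens_mulDr G m : {morph (fun F => htens (G * F) m) : F F' / F + F'}.
Proof. by move=> F F'; rewrite mulrDr htensDl. Qed.

Lemma eq_htensor (V : zmodType) (f g : htensor -> V) :
  {morph f : t u / t + u} -> {morph g : t u / t + u} ->
  (forall F m, f (htens F m) = g (htens F m)) -> f =1 g.
Proof. exact: eq_btensor. Qed.

Lemma htens_bal F h m : htens (F * delta h) m = htens F (hact h m).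
Proof. exact: (@btens_bal k T M H hract (@hact k H M) F h m). Qed.

Lemma hscale_balanced G :
  balanced hract (@hact k H M) (fun F m => htens (G * F) m).
Proof.
split=> [m F F'|F m m'|F h m]; first by rewrite mulrDr; exact: btensDl.
  exact: btensDr.
by rewrite /= mulrA htens_bal.
Qed.

Lemma hscaleD G : {morph hscale G : t u / t + u}.
Proof. exact: bliftD (hscale_balanced G). Qed.

Lemma hscale0 G : hscale G 0 = 0.
Proof. exact: blift0 (hscale_balanced G). Qed.

Lemma hscale_htens G F m : hscale G (htens F m) = htens (G * F) m.
Proof. exact: (blift_btens (hscale_balanced G)). Qed.

End HTensor.

Notation htensor2 := (htensor (@comul _ _)).
Notation htensor3 := (htensor (@comul3 _ _)).

Section Pseudo.
Variables (k : comNzRingType) (H : cocomHopfAlgType k).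

Definition pseudolinear (L M N : hmodType H)
    (mu : {linear (L ⊗ M)%type -> htensor2 N}) : Prop :=
  forall f g a b,
    mu (hact f a ⊗ hact g b) = hscale (f ⊗ g) (mu (a ⊗ b)).

(* Composition: for x * y = sum_i G_i ⊗_H e_i, [pshift_l F] and [pshift_r F]  *)
(* turn x * y into (F ⊗_H x) * y and x * (F ⊗_H y); [pcomp_l] and [pcomp_r]   *)
(* extend these additively in the argument lying in H^{⊗2} ⊗_H _.             *)
Section Composition.
Variables (L M N : hmodType H) (mu : {linear (L ⊗ M)%type -> htensor2 N}).
Implicit Types F G : (H ⊗ H)%type.

Definition pshift_l F : htensor2 N -> htensor3 N :=
  blift (fun G e => htens (@comul3 k H) ((F ⊗ 1) * comul_l G) e).

Definition pshift_r F : htensor2 N -> htensor3 N :=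
  blift (fun G e => htens (@comul3 k H) (tassoc (1 ⊗ F) * comul_r G) e).

Definition pcomp_l (t : htensor2 L) (y : M) : htensor3 N :=
  blift (fun F x => pshift_l F (mu (x ⊗ y))) t.

Definition pcomp_r (x : L) (t : htensor2 M) : htensor3 N :=
  blift (fun F y => pshift_r F (mu (x ⊗ y))) t.

Lemma pshift_l_balanced F : balanced (hract (@comul _ H)) (@hact k H N)
  (fun G e => htens (@comul3 k H) ((F ⊗ 1) * comul_l G) e).
Proof.
split=> [e G G'|G e e'|G h e].
- by rewrite comul_lD htens_mulDr.
- exact: htensDr.
- by rewrite -htens_bal comul_lM mulrA.
Qed.

Lemma pshift_r_balanced F : balanced (hract (@comul _ H)) (@hact k H N)
  (fun G e => htens (@comul3 k H) (tassoc (1 ⊗ F) * comul_r G) e).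
Proof.
split=> [e G G'|G e e'|G h e].
- by rewrite comul_rD htens_mulDr.
- exact: htensDr.
- by rewrite -htens_bal comul_rM comul_r_comul mulrA.
Qed.

Lemma pshift_l_htens F G e :
  pshift_l F (htens (@comul _ H) G e) = htens (@comul3 k H) ((F ⊗ 1) * comul_l G) e.
Proof. exact: (blift_btens (pshift_l_balanced F)). Qed.

Lemma pshift_r_htens F G e :
  pshift_r F (htens (@comul _ H) G e) =
  htens (@comul3 k H) (tassoc (1 ⊗ F) * comul_r G) e.
Proof. exact: (blift_btens (pshift_r_balanced F)). Qed.

Lemma pshift_lD F : {morph pshift_l F : t u / t + u}.
Proof. exact: (bliftD (pshift_l_balanced F)). Qed.

Lemma pshift_rD F : {morph pshift_r F : t u / t + u}.
Proof. exact: (bliftD (pshift_r_balanced F)). Qed.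

Lemma pshift_l_hscale F h t :
  pshift_l F (hscale (h ⊗ 1) t) = pshift_l (F * comul h) t.
Proof.
move: t; apply: eq_htensor => [t u|t u|G e].
- by rewrite hscaleD pshift_lD.
- exact: pshift_lD.
rewrite hscale_htens !pshift_l_htens comul_lM comul_l_tens mulrA.
by rewrite -embed_lM.
Qed.

Lemma pshift_r_hscale F h t :
  pshift_r F (hscale (1 ⊗ h) t) = pshift_r (F * comul h) t.
Proof.
move: t; apply: eq_htensor => [t u|t u|G e].
- by rewrite hscaleD pshift_rD.
- exact: pshift_rD.
rewrite hscale_htens !pshift_r_htens comul_rM comul_r_tens mulrA.
by rewrite -embed_rM.
Qed.

Lemma pcomp_l_balanced y : pseudolinear mu ->
  balanced (hract (@comul _ H)) (@hact k H L)
           (fun F x => pshift_l F (mu (x ⊗ y))).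
Proof.
move=> muH; split=> [x F F'|F x x'|F h x].
- rewrite /pshift_l /blift -big_split; apply: eq_bigr => p _.
  by rewrite embed_lD htens_mulDl.
- by rewrite tensDl linearD pshift_lD.
- by rewrite -[in RHS](hact1 y) muH pshift_l_hscale.
Qed.

Lemma pcomp_r_balanced x : pseudolinear mu ->
  balanced (hract (@comul _ H)) (@hact k H M)
           (fun F y => pshift_r F (mu (x ⊗ y))).
Proof.
move=> muH; split=> [y F F'|F y y'|F h y].
- rewrite /pshift_r /blift -big_split; apply: eq_bigr => p _.
  by rewrite embed_rD htens_mulDl.
- by rewrite tensDr linearD pshift_rD.
- by rewrite -[in RHS](hact1 x) muH pshift_r_hscale.
Qed.

Lemma pcomp_l_htens F x y : pseudolinear mu ->
  pcomp_l (htens (@comul _ H) F x) y = pshift_l F (mu (x ⊗ y)).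
Proof. by move=> muH; exact: (blift_btens (pcomp_l_balanced y muH)). Qed.

Lemma pcomp_r_htens F x y : pseudolinear mu ->
  pcomp_r x (htens (@comul _ H) F y) = pshift_r F (mu (x ⊗ y)).
Proof. by move=> muH; exact: (blift_btens (pcomp_r_balanced x muH)). Qed.

End Composition.

Definition omega_assoc_pseudoalgebra (Omega : semigroupType) (B : hmodType H)
    (mu : Omega -> Omega -> {linear (B ⊗ B)%type -> htensor2 B}) : Prop :=
  (forall al be, pseudolinear (mu al be)) /\
  (forall al be ga a b c,
     pcomp_l (mu (al * be)%g ga) (mu al be (a ⊗ b)) c =
     pcomp_r (mu al (be * ga)%g) a (mu be ga (b ⊗ c))).

End Pseudo.

Section FreeHModule.
Variables (k : comNzRingType) (H : algType k) (V : lmodType k).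

Definition free_hmod := (H ⊗ V)%type.
HB.instance Definition _ := GRing.Lmodule.on free_hmod.

Definition free_act (h : H) (t : free_hmod) : free_hmod :=
  tmap (h \*o idfun) idfun t.

Lemma free_act_bilin : bilin free_act.
Proof.
split=> [t c h h'|h t u c]; last exact: linearP.
elim/tensor_ind: t => [|a v t IHt]; first by rewrite /free_act !linear0 addr0.
rewrite /free_act !linearD /= !tmap_tens /= mulrDl -scalerAl tensDl tensZl.
by rewrite -!/(free_act _ _) IHt addrACA.
Qed.

Lemma free_actA g h t : free_act g (free_act h t) = free_act (g * h) t.
Proof.
elim/tensor_ind: t => [|a v t IHt]; first by rewrite /free_act !linear0.
rewrite /free_act !linearD /= !tmap_tens /= mulrA.
by rewrite -!/(free_act _ _) IHt.
Qed.

Lemma free_act1 t : free_act 1 t = t.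
Proof.
elim/tensor_ind: t => [|a v t IHt]; first by rewrite /free_act !linear0.
by rewrite /free_act linearD /= tmap_tens /= mul1r -/(free_act _ _) IHt.
Qed.

HB.instance Definition _ := Lmodule_isHModule.Build k H free_hmod
  free_act_bilin free_actA free_act1.

End FreeHModule.

(* Associative k-algebras, not required to have a unit. *)
HB.mixin Record Lmodule_isAssocAlgebra (k : comNzRingType) (A : Type)
    of GRing.Lmodule k A := {
  amul : A -> A -> A;
  amul_bilin : bilin amul;
  amulA : associative amul
}.

#[short(type="assocAlgType")]
HB.structure Definition AssocAlgebra (k : comNzRingType) :=
  {A of GRing.Lmodule k A & Lmodule_isAssocAlgebra k A}.

Definition rota_baxter_family (k : comNzRingType) (Omega : semigroupType)
    (A : assocAlgType k) (lambda : k) (P : Omega -> {linear A -> A}) : Prop :=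
  forall al be a b,
    amul (P al a) (P be b) =
    P (al * be)%g (amul (P al a) b + amul a (P be b) + lambda *: amul a b).

Section Subbialgebra.
Variables (k : comNzRingType) (H : bialgType k) (S : subalgClosed H).

Record subalg_of := SubalgOf {subalg_val : H; _ : subalg_val \in S}.
HB.instance Definition _ := [isSub for subalg_val].
HB.instance Definition _ := [Choice of subalg_of by <:].
HB.instance Definition _ := [SubChoice_isSubAlgebra of subalg_of by <:].

(* s lists pairs (a_(1), a_(2)) of elements of S with                         *)
(* Delta(a) = sum of a_(1) ⊗ a_(2).                                           *)
Definition sweedler (a : subalg_of) (s : seq (subalg_of * subalg_of)) : Prop :=
  comul (val a) = \sum_(p <- s) val p.1 ⊗ val p.2.

Definition is_subbialgebra : Prop := forall a, exists s, sweedler a s.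

End Subbialgebra.

(* Main.v *)
Require Import Defs.
From HB Require Import structures.
From mathcomp Require Import all_boot all_order all_algebra.
From mathcomp Require Import boolp classical_sets.

Set Implicit Arguments.
Unset Strict Implicit.
Unset Printing Implicit Defensive.

Import GRing.Theory.
Local Open Scope ring_scope.

(* The pseudoproduct only involves the coproduct of H' through the map        *)
(* H' -> H ⊗ H' : a |-> a_(1) ⊗ a_(2). Over a field H' has a linear           *)
(* retraction r : H -> H', so this map is (id ⊗ r) o Delta restricted to H'.  *)
(* It is thus linear, independent of the choice of a_(1) and a_(2), and       *)
(* inherits coassociativity from H. Both sides of associativity evaluate on   *)
(* generators to                                                              *)
(*   (f ⊗ g a_(1) ⊗ h b_(1) a_(2)) ⊗_H (1 ⊗ c b_(2) a_(3) ⊗ w),               *)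
(* where the two values of w in A agree by the Rota-Baxter identity.          *)

(** [H ⊗ (H' ⊗ A)] is a free [H]-module on [H' ⊗ A], so a pseudoproduct on it can be prescribed by a
    linear map [Q] on pairs of generators and extended by [H ⊗ H]-linearity ([pfree_mu],
    [pfree_mu_pseudolinear]). Here [Q] is [smash], which combines two independent ingredients: the
    coaction of [H] on [H'] given by the coproduct, coassociative by [coactionA], and the products
    [rb_mul] on [A], which satisfy a mixed associativity by [rb_mulA]. In [current_mu_assoc]
    additivity reduces associativity to generators; [sum_coactionA] then matches the coefficients in
    [H] and [H'], and the identity in [A] matches the last factor. *)

Lemma linear_retraction (k : fieldType) (V U : lmodType k)
    (i : {linear V -> U}) :
  injective i -> exists r : {linear U -> V}, cancel i r.
Proof.
move=> i_inj.
(* Zorn's lemma gives a maximal [W] among the subspaces meeting the image of [i] only in 0; [r] is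
   the projection along it. [P] has to admit the empty set, the union of the empty chain. *)
pose P (W : set U) := (forall (c : k) x y, W x -> W y -> W (c *: x + y)) /\
  (forall v, W (i v) -> v = 0).
have [F FP Ftot|W [[Wlin Wi] Wmax]] := @Zorn_bigcup U P.
  split=> [c x y [X FX Xx] [Y FY Yy]|v [X FX Xv]]; last exact: (FP X FX).2.
  have [XY|YX] := Ftot X Y FX FY.
    by exists Y => //; apply: (FP Y FY).1 => //; exact: XY.
  by exists X => //; apply: (FP X FX).1 => //; exact: YX.
(* [W] might be empty; adjoining 0 makes it a subspace in any case. *)
pose W0 u := u = 0 \/ W u.
have W0lin c x y : W0 x -> W0 y -> W0 (c *: x + y).
  have WZ d z : W z -> W (d *: z).
    move=> Wz; have := Wlin (d - 1) _ _ Wz Wz.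
    by rewrite scalerBl scale1r subrK.
  move=> [->|Wx] [->|Wy].
  - by left; rewrite scaler0 addr0.
  - by right; rewrite scaler0 add0r.
  - by right; rewrite addr0; exact: WZ.
  - by right; exact: Wlin.
have W0i v : W0 (i v) -> v = 0.
  by move=> [v0|/Wi//]; apply: i_inj; rewrite v0 linear0.
have dec u : exists v, W0 (u - i v).
  apply: contrapT => nu.
  (* If [u] were not in the sum of [W0] and the image of [i], the span of [u] and [W0] would
     contradict the maximality of [W]. *)
  pose W' : set U := fun z => exists c w, W0 w /\ z = c *: u + w.
  apply: (Wmax W'); last split.
  - split=> [w Ww|WW].
      by exists 0, w; split; [right|rewrite scale0r add0r].
    apply: nu; exists 0; rewrite linear0 subr0; right; apply: WW.
    by exists 1, 0; split; [left|rewrite scale1r addr0].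
  - move=> c _ _ [d [w [Ww ->]]] [e [w' [Ww' ->]]].
    exists (c * d + e), (c *: w + w'); split; first exact: W0lin.
    by rewrite scalerDr scalerDl scalerA addrACA.
  - move=> v [c [w [Ww vE]]].
    have [c0|c0] := eqVneq c 0.
      by apply: W0i; rewrite vE c0 scale0r add0r.
    exfalso; apply: nu; exists (c^-1 *: v).
    rewrite linearZ /= vE scalerDr scalerA mulVf // scale1r opprD addNKr.
    by rewrite -scaleNr -[_ *: w]addr0; apply: W0lin => //; left.
have [r rP] := choice dec.
have rE u v : W0 (u - i v) -> r u = v.
  move=> uv; apply/eqP; rewrite eq_sym -subr_eq0; apply/eqP/W0i.
  rewrite linearB /=.
  have -> : i v - i (r u) = -1 *: (u - i v) + (u - i (r u)).
    by rewrite scaleN1r opprB addrA subrK.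
  exact: W0lin.
have r_lin : linear r.
  move=> c x y; apply: rE.
  have -> : c *: x + y - i (c *: r x + r y) =
            c *: (x - i (r x)) + (y - i (r y)).
    by rewrite linearP /= scalerBr opprD addrACA.
  exact: W0lin.
exists (HB.pack_for {linear U -> V} r (GRing.isLinear.Build k U V *:%R r r_lin)).
by move=> v /=; apply: rE; left; rewrite subrr.
Qed.

(** * Linear maps between tensor products *)

Section TensorMaps.
Variable k : comNzRingType.
Implicit Types X Y Z V W : lmodType k.

Lemma eq_linear_tensor X Y V (f g : {linear (X ⊗ Y)%type -> V}) :
  (forall x y, f (x ⊗ y) = g (x ⊗ y)) -> f =1 g.
Proof. by apply: eq_tensor; exact: linearD. Qed.

Section Unassoc.
Variables X Y Z : lmodType k.

(** The inverse of [tassoc], written as a composite of linear maps so that its linearity is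
    inferred. *)
Definition tunassoc : (X ⊗ Y) ⊗ Z -> X ⊗ (Y ⊗ Z) :=
  tmap idfun (@tswap k Z Y) \o (@tswap k _ X \o (@tassoc k Z Y X \o
    (tmap idfun (@tswap k X Y) \o @tswap k (X ⊗ Y)%type Z))).
HB.instance Definition _ := GRing.Linear.on tunassoc.

Lemma tunassoc_tens x y z : tunassoc ((x ⊗ y) ⊗ z) = x ⊗ (y ⊗ z).
Proof.
rewrite /tunassoc /= tswap_tens tmap_tens /= tswap_tens tassoc_tens tswap_tens.
by rewrite tmap_tens /= tswap_tens.
Qed.

End Unassoc.

Section Exchange.
Variables X Y Z W : lmodType k.

Definition texch : (X ⊗ Y) ⊗ (Z ⊗ W) -> (X ⊗ Z) ⊗ (Y ⊗ W) :=
  @tunassoc (X ⊗ Z)%type Y W \o (tmap (@tassoc k X Z Y) idfun \o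
    (tmap (tmap idfun (@tswap k Y Z)) idfun \o
      (tmap (@tunassoc X Y Z) idfun \o @tassoc k (X ⊗ Y)%type Z W))).
HB.instance Definition _ := GRing.Linear.on texch.

Lemma texch_tens x y z w : texch ((x ⊗ y) ⊗ (z ⊗ w)) = (x ⊗ z) ⊗ (y ⊗ w).
Proof.
rewrite /texch /= tassoc_tens !tmap_tens /= tunassoc_tens tmap_tens /= tswap_tens.
by rewrite tassoc_tens tunassoc_tens.
Qed.

End Exchange.

Lemma tassoc_tmap X Y Z X' Y' Z' (f : {linear X -> X'}) (g : {linear Y -> Y'})
    (h : {linear Z -> Z'}) t :
  tassoc (tmap f (tmap g h) t) = tmap (tmap f g) h (tassoc t).
Proof.
move: t; apply: eq_tensor => [t u|t u|x yz]; rewrite ?linearD //.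
elim/tensor_ind: yz => [|y z u IHu]; first by rewrite tens0r !linear0.
rewrite tensDr !linearD /= IHu; congr (_ + _).
by rewrite tassoc_tens !tmap_tens /= !tmap_tens tassoc_tens.
Qed.

Lemma tmap_tmap X Y X' Y' X'' Y'' (f : {linear X -> X'}) (g : {linear Y -> Y'})
    (f' : {linear X' -> X''}) (g' : {linear Y' -> Y''}) t :
  tmap f' g' (tmap f g t) = tmap (f' \o f) (g' \o g) t.
Proof.
move: t; apply: eq_tensor => [t u|t u|x y]; rewrite ?linearD //.
by rewrite !tmap_tens.
Qed.

Lemma tmap_id X Y (t : X ⊗ Y) : tmap idfun idfun t = t.
Proof.
by move: t; apply: eq_tensor => [t u|t u|x y]; rewrite ?linearD ?tmap_tens.
Qed.

Lemma eq_tmap X Y X' Y' (f f' : {linear X -> X'}) (g g' : {linear Y -> Y'}) :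
  f =1 f' -> g =1 g' -> tmap f g =1 tmap f' g'.
Proof.
by move=> ff gg; apply: eq_linear_tensor => x y; rewrite /= !tmap_tens ff gg.
Qed.

Lemma eq_tensor3 X Y Z (V : zmodType) (f g : X ⊗ (Y ⊗ Z) -> V) :
  {morph f : t u / t + u} -> {morph g : t u / t + u} ->
  (forall x y z, f (x ⊗ (y ⊗ z)) = g (x ⊗ (y ⊗ z))) -> f =1 g.
Proof.
move=> fD gD fg; apply: eq_tensor => // x.
by apply: eq_tensor => [t u|t u|y z]; rewrite ?tensDr ?fD ?gD.
Qed.

End TensorMaps.
Arguments tunassoc {k X Y Z} t : simpl never.
Arguments texch {k X Y Z W} t : simpl never.

Lemma tlift_bilin (k : comNzRingType) (X Y Z V : lmodType k)
    (f : X -> Y -> Z -> V) :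
  (forall x, bilin (f x)) -> (forall y z, linear (fun x => f x y z)) ->
  bilin (fun x => tlift (f x)).
Proof.
move=> fb fl; split=> [t c x x'|x]; last exact: tlift_is_linear.
elim/tensor_ind: t => [|y z t IHt].
  by rewrite !(lin0 (tlift_is_linear (fb _))) scaler0 addr0.
rewrite !(linD (tlift_is_linear (fb _))) IHt !tlift_tens //.
by rewrite fl scalerDr addrACA.
Qed.

(** * Bilinearity of the tensor over [H] and additivity of composition *)

Section HTensorScale.
Variables (k : comNzRingType) (H T : algType k) (delta : {linear H -> T}).
Variable M : hmodType H.
Hypothesis delta1 : delta 1 = 1.

Lemma hact_scalar c (m : M) : hact c%:A m = c *: m.
Proof. by rewrite (linZ (hact_bilin.1 m)) hact1. Qed.

Lemma htensZl c (F : T) (m : M) : htens delta (c *: F) m = c *: htens delta F m.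
Proof. exact: btensZl. Qed.

(** A scalar acts on [M] as [c%:A] in [H]; balancing moves it to the left factor, where [delta1]
    turns it back into a scalar. *)
Lemma htensZr c (F : T) (m : M) : htens delta F (c *: m) = c *: htens delta F m.
Proof.
by rewrite -htensZl -hact_scalar -htens_bal linearZ /= delta1 mulr_algr.
Qed.

Lemma htens_bilin : bilin (htens delta (M := M)).
Proof.
split=> [m c F F'|F c m m']; first by rewrite htensDl htensZl.
by rewrite htensDr htensZr.
Qed.

End HTensorScale.

Section PseudoCompositionAdditivity.
Variables (k : comNzRingType) (H : cocomHopfAlgType k) (L M N : hmodType H).
Variables (mu : {linear (L ⊗ M)%type -> htensor2 N}) (muH : pseudolinear mu).

(** Additivity in the argument lying in the tensor over [H] rests on the balancedness supplied by
    [muH]; additivity in the other argument, below, holds term by term on the chosen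
    representative. *)
Lemma pcomp_lDl y : {morph (pcomp_l mu)^~ y : t u / t + u}.
Proof. exact: bliftD (pcomp_l_balanced y muH). Qed.

Lemma pcomp_rDr x : {morph pcomp_r mu x : t u / t + u}.
Proof. exact: bliftD (pcomp_r_balanced x muH). Qed.

Lemma pcomp_lDr t : {morph pcomp_l mu t : y z / y + z}.
Proof.
move=> y z; rewrite /pcomp_l /blift -big_split; apply: eq_bigr => p _.
by rewrite tensDr linearD pshift_lD.
Qed.

Lemma pcomp_rDl t : {morph (pcomp_r mu)^~ t : y z / y + z}.
Proof.
move=> y z; rewrite /pcomp_r /blift -big_split; apply: eq_bigr => p _.
by rewrite tensDl linearD pshift_rD.
Qed.

End PseudoCompositionAdditivity.

Lemma morph_sum (V W : zmodType) (f : V -> W) (I : Type) (s : seq I) F :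
  {morph f : t u / t + u} -> f (\sum_(i <- s) F i) = \sum_(i <- s) f (F i).
Proof.
move=> fD; apply: (big_morph f fD).
by apply: (addrI (f 0)); rewrite -fD !addr0.
Qed.

(** * Pseudoproducts on free [H]-modules *)

Section FreeLift.
Variables (k : comNzRingType) (H : bialgType k) (V : lmodType k).
Let B : hmodType H := free_hmod H V.

(** [F] holds the [H]-coefficients of the two arguments, and [h ⊗ v] is a term of the product of
    their generators. *)
Definition pfree : (H ⊗ H) ⊗ (H ⊗ V) -> htensor2 B :=
  tlift (fun F => tlift (fun h v => htens (@comul k H) (F * (1 ⊗ h)) (1 ⊗ v : B))).

Lemma htens2_bilin : bilin (htens (@comul k H) (M := B)).
Proof. exact/htens_bilin/rmorph1. Qed.

Lemma pfree_bilin_in F :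
  bilin (fun h v => htens (@comul k H) (F * (1 ⊗ h)) (1 ⊗ v : B)).
Proof.
split=> [v c h h'|h c v v'].
  by rewrite tensDr tensZr mulrDr -scalerAr htens2_bilin.1.
by rewrite tensDr tensZr htens2_bilin.2.
Qed.

Lemma pfree_bilin : bilin (fun F => tlift (fun h v =>
  htens (@comul k H) (F * (1 ⊗ h)) (1 ⊗ v : B))).
Proof.
apply: tlift_bilin pfree_bilin_in _ => h v c F F'.
by rewrite mulrDl -scalerAl htens2_bilin.1.
Qed.

HB.instance Definition _ := GRing.isLinear.Build k _ _ *:%R pfree
  (tlift_is_linear pfree_bilin).

Lemma pfree_tens F h v :
  pfree (F ⊗ (h ⊗ v)) = htens (@comul k H) (F * (1 ⊗ h)) (1 ⊗ v : B).
Proof.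
by rewrite /pfree tlift_tens ?tlift_tens //;
  [exact: pfree_bilin_in|exact: pfree_bilin].
Qed.

Lemma pfree_mul G F t : pfree ((G * F) ⊗ t) = hscale G (pfree (F ⊗ t)).
Proof.
elim/tensor_ind: t => [|h v t IHt]; first by rewrite !tens0r !linear0 hscale0.
rewrite !tensDr !linearD /= hscaleD IHt; congr (_ + _).
by rewrite !pfree_tens hscale_htens mulrA.
Qed.

Variable Q : {linear (V ⊗ V)%type -> (H ⊗ V)%type}.

Definition pfree_mu : B ⊗ B -> htensor2 B :=
  pfree \o (tmap idfun Q \o @texch k H V H V).
HB.instance Definition _ := GRing.Linear.on pfree_mu.

Lemma pfree_muE f g v w :
  pfree_mu ((f ⊗ v : B) ⊗ (g ⊗ w : B)) = pfree ((f ⊗ g) ⊗ Q (v ⊗ w)).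
Proof. by rewrite /pfree_mu /= texch_tens tmap_tens. Qed.

End FreeLift.

Lemma pfree_mu_pseudolinear (k : comNzRingType) (H : cocomHopfAlgType k)
    (V : lmodType k) (Q : {linear (V ⊗ V)%type -> (H ⊗ V)%type}) :
  @pseudolinear k H (free_hmod H V) (free_hmod H V) (free_hmod H V) (pfree_mu Q).
Proof.
have hactD h := linD ((@hact_bilin k H (free_hmod H V)).2 h).
have hactE h f v : hact h (f ⊗ v : free_hmod H V) = (h * f) ⊗ v.
  exact: tmap_tens.
move=> f g t u; move: t; apply: eq_tensor => [t t'|t t'|f' v].
- by rewrite hactD tensDl linearD.
- by rewrite tensDl linearD /= hscaleD.
move: u; apply: eq_tensor => [u u'|u u'|g' w].
- by rewrite hactD tensDr linearD.
- by rewrite tensDr linearD /= hscaleD.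
by rewrite !hactE /= !pfree_muE -tensM pfree_mul.
Qed.

(** * The coaction of [H] on a subbialgebra *)

Section Coaction.
Variables (k : comNzRingType) (H : bialgType k) (S : subalgClosed H).
Local Notation S' := (subalg_of S).
Variable r : {linear H -> S'}.
Hypothesis rK : cancel val r.

Definition coaction : S' -> H ⊗ S' := tmap idfun r \o (@comul k H \o val).
HB.instance Definition _ := GRing.Linear.on coaction.

Lemma coaction_sweedler a s :
  sweedler a s -> coaction a = \sum_(p <- s) val p.1 ⊗ p.2.
Proof.
move=> sa; rewrite /coaction /= sa linear_sum; apply: eq_bigr => p _.
by rewrite /= tmap_tens /= rK.
Qed.

Hypothesis hS : is_subbialgebra S.

Lemma tmap_val_coaction a : tmap idfun val (coaction a) = comul (val a).
Proof.
have [s sa] := hS a; rewrite (coaction_sweedler sa) sa linear_sum.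
by apply: eq_bigr => p _; rewrite /= tmap_tens.
Qed.

(** Both sides are images under [id ⊗ id ⊗ r] of the two sides of coassociativity in [H] at
    [val a]. *)
Lemma coactionA a :
  tassoc (tmap idfun coaction (coaction a)) = tmap comul idfun (coaction a).
Proof.
transitivity (tassoc (tmap idfun (tmap idfun r) (tmap idfun comul
                (tmap idfun val (coaction a))))).
  congr (tassoc _); rewrite !tmap_tmap; exact: eq_tmap.
rewrite tmap_val_coaction tassoc_tmap -[tassoc _]/(comul_r _) comulA /comul_l.
rewrite /coaction /= !tmap_tmap; apply: eq_tmap => // x /=.
by rewrite tmap_id.
Qed.

End Coaction.

(** * The family of products on [A] *)

Section RotaBaxterProduct.
Variables (k : comNzRingType) (Omega : semigroupType) (A : assocAlgType k).
Variables (lambda : k) (P : Omega -> {linear A -> A}).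

Definition rb_mul al be (x y : A) : A :=
  amul (P al x) y + amul x (P be y) + lambda *: amul x y.

Lemma rb_mul_bilin al be : bilin (rb_mul al be).
Proof.
have [ml mr] := @amul_bilin k A.
split=> [y c x x'|x c y y']; rewrite /rb_mul linearP !(ml, mr) !scalerDr !scalerA.
  by rewrite [lambda * c]mulrC [RHS]addrACA; congr (_ + _); exact: addrACA.
by rewrite [lambda * c]mulrC [RHS]addrACA; congr (_ + _); exact: addrACA.
Qed.

Lemma rb_mulA (hP : rota_baxter_family lambda P) al be ga x y z :
  rb_mul (al * be)%g ga (rb_mul al be x y) z =
  rb_mul al (be * ga)%g x (rb_mul be ga y z).
Proof.
have [ml mr] := @amul_bilin k A.
have mDl u v w : amul (u + v) w = amul u w + amul v w := linD (ml w) u v.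
have mDr u v w : amul w (u + v) = amul w u + amul w v := linD (mr w) u v.
have mZl c u w : amul (c *: u) w = c *: amul u w := linZ (ml w) c u.
have mZr c u w : amul w (c *: u) = c *: amul w u := linZ (mr w) c u.
(* The Rota-Baxter identity turns each operator with a product index, applied to an inner product,
   into a product of two values. Both sides then expand to the same seven monomials. *)
rewrite /rb_mul -(hP al be x y) -(hP be ga y z).
rewrite !mDl !mDr !mZl !mZr !scalerDr -!amulA -!addrA.
congr (_ + (_ + _)).
rewrite (addrCA (_ *: amul x (amul y _))) (addrCA (amul x _)).
by rewrite [in LHS](addrCA (_ *: amul x (amul y _)) (_ *: amul x _)).
Qed.

End RotaBaxterProduct.

(** * The product of two generators *)

Section Product.
Variables (k : comNzRingType) (H : bialgType k) (S : subalgClosed H).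
Local Notation S' := (subalg_of S).
Variables (D : {linear S' -> (H ⊗ S')%type}) (A : lmodType k) (z : A -> A -> A).
Hypothesis z_bilin : bilin z.
Hypothesis DS : forall a s, sweedler a s -> D a = \sum_(p <- s) val p.1 ⊗ p.2.

(** The order is reversed because [a_(2)] stands to the left of [b] in the tensor, while the
    pseudoproduct involves [b a_(2)]. *)
Definition mulr_swap : S' ⊗ S' -> S' := tlift (fun a b => b * a).

Lemma mulr_swap_bilin : bilin (fun a b : S' => b * a).
Proof.
by split=> [b c a a'|a c b b']; rewrite ?mulrDr ?mulrDl -?scalerAr -?scalerAl.
Qed.

HB.instance Definition _ := GRing.isLinear.Build k _ _ *:%R mulr_swap
  (tlift_is_linear mulr_swap_bilin).

Lemma mulr_swap_tens a b : mulr_swap (a ⊗ b) = b * a.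
Proof. exact: tlift_tens mulr_swap_bilin. Qed.

Definition zlift : A ⊗ A -> A := tlift z.
HB.instance Definition _ := GRing.isLinear.Build k _ _ *:%R zlift
  (tlift_is_linear z_bilin).

Definition smash : (S' ⊗ A) ⊗ (S' ⊗ A) -> H ⊗ (S' ⊗ A) :=
  @tunassoc k H S' A \o (tmap (tmap idfun mulr_swap \o
    (@tunassoc k H S' S' \o tmap D idfun)) zlift \o @texch k S' A S' A).
HB.instance Definition _ := GRing.Linear.on smash.

Lemma smashE a b x y s : sweedler a s ->
  smash ((a ⊗ x) ⊗ (b ⊗ y)) =
  \sum_(p <- s) val p.1 ⊗ ((b * p.2) ⊗ z x y).
Proof.
move=> /DS Da; rewrite /smash /= texch_tens tmap_tens /= tmap_tens /= Da.
have -> : zlift (x ⊗ y) = z x y by exact: tlift_tens.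
(* [F] is additive in the coaction value [t], so the Sweedler sum can be pulled out. *)
pose F (t : H ⊗ S') := tunassoc (tmap idfun mulr_swap (tunassoc (t ⊗ b)) ⊗ z x y).
have FD : {morph F : t u / t + u}.
  by move=> t u; rewrite /F tensDl !linearD /= tensDl linearD.
rewrite -[LHS]/(F _) (morph_sum _ _ FD); apply: eq_bigr => p _.
by rewrite /F tunassoc_tens tmap_tens /= mulr_swap_tens tunassoc_tens.
Qed.

End Product.

Lemma sweedlerM (k : comNzRingType) (H : bialgType k) (S : subalgClosed H)
    (a b : subalg_of S) s t : sweedler a s -> sweedler b t ->
  sweedler (a * b) [seq (p.1 * q.1, p.2 * q.2) | p <- s, q <- t].
Proof.
rewrite /sweedler (rmorphM val) (rmorphM (@comul k H)) /= => -> ->.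
rewrite big_allpairs_dep mulr_suml; apply: eq_bigr => p _.
by rewrite mulr_sumr; apply: eq_bigr => q _; rewrite tensM.
Qed.

(** * Associativity in the threefold tensor over [H] *)

Section Comul3.
Variables (k : comNzRingType) (H : bialgType k).

Lemma comul3_is_linear : linear (@comul3 k H).
Proof. by move=> c g h; rewrite /comul3 /comul_l !linearP. Qed.

HB.instance Definition _ :=
  GRing.isLinear.Build k H _ *:%R (@comul3 k H) comul3_is_linear.

Lemma htens3_bilin (M : hmodType H) : bilin (htens (@comul3 k H) (M := M)).
Proof.
apply: htens_bilin; rewrite /= /comul3 (rmorph1 (@comul k H)) -tens11.
by rewrite comul_l_tens (rmorph1 (@comul k H)) tens11.
Qed.

End Comul3.

Section Associativity.
Variables (k : comNzRingType) (H : cocomHopfAlgType k) (S : subalgClosed H).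
Local Notation S' := (subalg_of S).
Variable r : {linear H -> S'}.
Hypothesis rK : cancel val r.
Hypothesis hS : is_subbialgebra S.

(** Coassociativity for chosen Sweedler decompositions: [sig] need not be linear, but both sums are
    [tlift phi] applied to the two sides of [coactionA]. *)
Lemma sum_coactionA (V : lmodType k) (phi : (H ⊗ H)%type -> S' -> V) sig a :
  bilin phi -> (forall a, sweedler a (sig a)) ->
  \sum_(p <- sig a) \sum_(q <- sig p.2) phi (val p.1 ⊗ val q.1) q.2 =
  \sum_(p <- sig a) phi (comul (val p.1)) p.2.
Proof.
move=> phib sigP; have Da := coaction_sweedler rK (sigP _).
have := congr1 (tlift phi) (coactionA rK hS a).
have liftD := linD (tlift_is_linear phib).
rewrite Da.
have e1D : {morph (fun t => tlift phi (tassoc (tmap idfun (coaction r) t))) :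
  t u / t + u} by move=> t u; rewrite !linearD liftD.
have e2D : {morph (fun t => tlift phi (tmap comul idfun t)) : t u / t + u}.
  by move=> t u; rewrite !linearD liftD.
rewrite (morph_sum _ _ e1D) (morph_sum _ _ e2D) => E.
transitivity (\sum_(p <- sig a) tlift phi
  (tassoc (tmap idfun (coaction r) (val p.1 ⊗ p.2)))).
  apply: eq_bigr => p _; rewrite tmap_tens /= Da.
  have e3D : {morph (fun t => tlift phi (tassoc (val p.1 ⊗ t))) : t u / t + u}.
    by move=> t u; rewrite tensDr linearD liftD.
  rewrite (morph_sum _ _ e3D); apply: eq_bigr => q _.
  by rewrite tassoc_tens tlift_tens.
by rewrite E; apply: eq_bigr => p _; rewrite tmap_tens /= tlift_tens.
Qed.

Variables (A : lmodType k).
Let B : hmodType H := free_hmod H (S' ⊗ A)%type.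
Let gen f a x : B := f ⊗ (a ⊗ x).

Section Mu.
Variables (z : A -> A -> A) (z_bilin : bilin z).

Definition current_mu : {linear (B ⊗ B)%type -> htensor2 B} :=
  pfree_mu (smash (coaction r) z_bilin).

Lemma current_muE f g a b x y s : sweedler a s ->
  current_mu (gen f a x ⊗ gen g b y) = \sum_(p <- s)
    htens (@comul k H) (f ⊗ (g * val p.1)) (gen 1 (b * p.2) (z x y)).
Proof.
move=> sa; rewrite /current_mu /gen /= pfree_muE.
rewrite /= (smashE z_bilin (coaction_sweedler rK) _ _ _ sa).
have FD : {morph (fun t : H ⊗ (S' ⊗ A) => pfree (f ⊗ g ⊗ t)) : t u / t + u}.
  by move=> t u; rewrite /= tensDr linearD.
rewrite (morph_sum _ _ FD); apply: eq_bigr => p _.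
by rewrite pfree_tens tensM mulr1.
Qed.

Lemma current_mu_pseudolinear : pseudolinear current_mu.
Proof. exact: pfree_mu_pseudolinear. Qed.

End Mu.

Lemma current_mu_assoc z1 z2 z3 z4 (b1 : bilin z1) (b2 : bilin z2)
    (b3 : bilin z3) (b4 : bilin z4) :
  (forall x y w, z2 (z1 x y) w = z3 x (z4 y w)) ->
  forall u v w, pcomp_l (current_mu b2) (current_mu b1 (u ⊗ v)) w =
                pcomp_r (current_mu b3) u (current_mu b4 (v ⊗ w)).
Proof.
move=> zA u v w.
have [sig sigP] := choice hS.
have pl := current_mu_pseudolinear.
have lDl := pcomp_lDl (pl _ b2); have lDr := pcomp_lDr (current_mu b2).
have rDr := pcomp_rDr (pl _ b3); have rDl := pcomp_rDl (current_mu b3).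
move: u; apply: eq_tensor3 => [u u'|u u'|f a x].
- by rewrite tensDl linearD lDl.
- exact: rDl.
move: v; apply: eq_tensor3 => [v v'|v v'|g b y].
- by rewrite tensDr linearD lDl.
- by rewrite tensDl linearD rDr.
move: w; apply: eq_tensor3 => [w w'|w w'|h c t].
- exact: lDr.
- by rewrite tensDr linearD rDr.
rewrite -![_ ⊗ (_ ⊗ _)]/(gen _ _ _).
rewrite (current_muE b1 _ _ _ _ _ (sigP a)) (current_muE b4 _ _ _ _ _ (sigP b)).
rewrite (morph_sum _ _ (lDl _)) (morph_sum _ _ (rDr _)).
have muH2 := pl _ b2; have muH3 := pl _ b3.
(* The left side in normal form: [sweedlerM] splits the coproduct of [b a_(2)], with [p'] running
   over the coproduct of [a_(2)]. *)
transitivity (\sum_(p <- sig a) \sum_(q <- sig b) \sum_(p' <- sig p.2)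
  htens (@comul3 k H) (tassoc (f ⊗ ((g ⊗ (h * val q.1)) * (val p.1 ⊗ val p'.1))))
    (gen 1 (c * q.2 * p'.2) (z2 (z1 x y) t))).
  apply: eq_bigr => p _; rewrite (pcomp_l_htens _ _ _ muH2).
  rewrite (current_muE b2 _ _ _ _ _ (sweedlerM (sigP b) (sigP p.2))).
  rewrite (morph_sum _ _ (pshift_lD _)) big_allpairs_dep.
  apply: eq_bigr => q _; apply: eq_bigr => p' _.
  rewrite pshift_l_htens comul_l_tens rmorph1 rmorphM /=.
  by rewrite [(f ⊗ _ ⊗ _) * _]tensM mulr1 mul1r tensM tassoc_tens !mulrA.
rewrite exchange_big; apply: eq_bigr => q _ /=.
rewrite (pcomp_r_htens _ _ _ muH3) (current_muE b3 _ _ _ _ _ (sigP a)).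
rewrite (morph_sum _ _ (pshift_rD _)).
(* For fixed [q] the sum over [p] and [p'] is a bilinear expression in [a_(1) ⊗ a_(2)] and [a_(3)];
   coassociativity replaces that pair by [comul] of the first leg, the form produced by
   [pshift_r]. *)
pose phi F (s : S') := htens (@comul3 k H) (tassoc (f ⊗ ((g ⊗ (h * val q.1)) * F)))
    (gen 1 (c * q.2 * s) (z2 (z1 x y) t)).
rewrite -[LHS]/(\sum_(p <- sig a) \sum_(p' <- sig p.2)
  phi (val p.1 ⊗ val p'.1) p'.2) sum_coactionA //; last first.
  have hb := @htens3_bilin k H B.
  split=> [s d F F'|F d s s']; rewrite /phi.
    by rewrite mulrDr -scalerAr tensDr tensZr linearP hb.1.
  rewrite mulrDr -scalerAr /gen [(d *: _ + _) ⊗ _]tensDl tensZl.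
  by rewrite [1 ⊗ (_ + _)]tensDr tensZr hb.2.
apply: eq_bigr => p _; rewrite pshift_r_htens comul_r_tens /phi zA.
by rewrite -[_ * tassoc _]tassocM tensM !mul1r.
Qed.

End Associativity.

Theorem corollary3p7 (k : closedFieldType) (k_char0 : [pchar k] =i pred0)
    (H : cocomHopfAlgType k) (Omega : semigroupType) (lambda : k)
    (A : assocAlgType k) (P : Omega -> {linear A -> A})
    (hP : rota_baxter_family lambda P)
    (H' : subalgClosed H) (hH' : is_subbialgebra H') :
  let B : hmodType H := free_hmod H (subalg_of H' ⊗ A)%type in
  let gen (f : H) (a : subalg_of H') (x : A) : B := f ⊗ (a ⊗ x) in
  exists mu : Omega -> Omega -> {linear (B ⊗ B)%type -> htensor2 B},
    omega_assoc_pseudoalgebra mu /\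
    forall (al be : Omega) (f g : H) (a b : subalg_of H') (x y : A)
      (s : seq (subalg_of H' * subalg_of H')),
      sweedler a s ->
      mu al be (gen f a x ⊗ gen g b y) =
      \sum_(p <- s)
        htens (@comul k H) (f ⊗ (g * val p.1))
          (gen 1 (b * p.2)
             (amul (P al x) y + amul x (P be y) + lambda *: amul x y)).
Proof.
move=> B gen.
(* The coaction is built from one retraction [r]; by [rK] it agrees with every Sweedler
   decomposition [s]. *)
have [r rK] := linear_retraction (i := val : {linear subalg_of H' -> H}) val_inj.
exists (fun al be => current_mu r (rb_mul_bilin lambda P al be)).
split; [split=> [al be|al be ga]|move=> al be f g a b x y s].
- exact: current_mu_pseudolinear.
- by apply: current_mu_assoc => // x y w; exact: rb_mulA.
- exact: current_muE.
Qed.
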